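(* Let $g\in GS_2(I,X,\beta)$ be a generalized quadratic spline. The sequence $(P_m)_{m\ge 0}$ of spline control polygons associated with $g$, obtained by successive applications of the global corner-cutting algorithm, converges uniformly on $I$ to $g$.
   Context: Setting. Let $n\ge 1$, $I=[a,b]$, $X=\{a=x_0<x_1<\dots<x_n=b\}$ a partition of $I$, $I_i=[x_{i-1},x_i]$, $h_i=x_i-x_{i-1}$, $m_i=\frac12(x_{i-1}+x_i)$ for $1\le i\le n$. Let $\beta=(\beta_1,\dots,\beta_n)$ with $\beta_i\in[-1,0[$ and $\theta_i=\frac12\frac{\beta_i}{\beta_i-1}\in\,]0,\frac14]$ (equivalently $\beta_i=\frac{-2\theta_i}{1-2\theta_i}$). The space $V(\beta_i)$ (generated by the Merrien subdivision algorithm) is the set of $C^1$ functions $f$ on $I_i$ such that for every dyadic subinterval $[u,v]$ of $I_i$ (i.e. every interval obtained from $I_i$ by repeated bisection, including $I_i$ itself), with $m=\frac12(u+v)$ and $h=v-u$, $$f(m)=\tfrac12\big(f(u)+f(v)-\theta_i h\,(f'(v)-f'(u))\big),\qquad f'(m)=\frac{1}{1-2\theta_i}\Big(\frac{f(v)-f(u)}{h}-2\theta_i\,\frac{f'(u)+f'(v)}{2}\Big).$$ It is known that for any prescribed values of $f,f'$ at the two endpoints of $I_i$ there is exactly one such $f$; so $\dim V(\beta_i)=4$. $GS_2(\beta)=GS_2(I,X,\beta)$ is the space of all $g\in C^1(I)$ with $g|_{I_i}\in V(\beta_i)$ for all $1\le i\le n$ (generalized quadratic splines); it has dimension $2n+2$.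 The list of B-coefficients of $f\in V(\beta_i)$ on $I_i$ is $[\,f(x_{i-1}),\ f(x_{i-1})+\theta_ih_if'(x_{i-1}),\ f(x_i)-\theta_ih_if'(x_i),\ f(x_i)\,]$; it determines $f$ uniquely. For $1\le i\le n-1$ let $\omega_i=\frac{\theta_{i+1}h_{i+1}}{\theta_ih_i+\theta_{i+1}h_{i+1}}$, and let $\omega_0=1$, $\omega_n=0$. The generalized quadratic B-splines are the functions on $I$ defined by their B-coefficients as follows (all B-coefficients on subintervals not mentioned are zero). For $1\le i\le n-1$: $B_{2i}$ has lists $[0,0,1,\omega_i]$ on $I_i$ and $[\omega_i,0,0,0]$ on $I_{i+1}$; $B_{2i+1}$ has lists $[0,0,0,1-\omega_i]$ on $I_i$ and $[1-\omega_i,1,0,0]$ on $I_{i+1}$. At the ends: $B_0$ has list $[1,0,0,0]$ on $I_1$; $B_1$ has list $[0,1,0,0]$ on $I_1$; $B_{2n}$ has list $[0,0,1,0]$ on $I_n$; $B_{2n+1}$ has list $[0,0,0,1]$ on $I_n$. The family $\{B_k\}_{0\le k\le 2n+1}$ is a basis of $GS_2(\beta)$. Spline control polygon. Put $\xi_0=x_0$, $\xi_i=x_i-\theta_ih_i$ for $1\le i\le n$, $\eta_i=x_i+\theta_{i+1}h_{i+1}$ for $0\le i\le n-1$, $\eta_n=x_n$, so that $\xi_0<\eta_0<\xi_1<\eta_1<\dots<\xi_n<\eta_n$. The spline control polygon (SCP) of $g=\sum_{k=0}^{2n+1}\gamma_kB_k$, with respect to $(X,\beta)$, is the continuous piecewise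 linear function on $I$ whose graph has consecutive vertices $(\xi_i,\gamma_{2i})$ and $(\eta_i,\gamma_{2i+1})$, $0\le i\le n$. Corner-cutting sequence. Let $\bar X=X\cup\{m_i,\ 1\le i\le n\}$ and $\bar\beta=(\beta_1,\beta_1,\beta_2,\beta_2,\dots,\beta_n,\beta_n)$; then $GS_2(I,X,\beta)\subset GS_2(I,\bar X,\bar\beta)$. The global corner-cutting algorithm maps the coefficients $(\gamma_k)_{0\le k\le 2n+1}$ of $g$ in the B-spline basis of $GS_2(I,X,\beta)$ to its coefficients $(\delta_l)_{0\le l\le 4n+1}$ in the B-spline basis of $GS_2(I,\bar X,\bar\beta)$, namely $\delta_{4i-2}=(\frac12-\frac14\beta_i)\gamma_{2i-1}+(\frac12+\frac14\beta_i)\gamma_{2i}$ and $\delta_{4i-1}=(\frac12+\frac14\beta_i)\gamma_{2i-1}+(\frac12-\frac14\beta_i)\gamma_{2i}$ for $1\le i\le n$, and $\delta_{4i}=\frac12(1+\omega_i)\gamma_{2i}+\frac12(1-\omega_i)\gamma_{2i+1}$ and $\delta_{4i+1}=\frac12\omega_i\gamma_{2i}+\frac12(2-\omega_i)\gamma_{2i+1}$ for $0\le i\le n$. Set $(X^{(0)},\beta^{(0)})=(X,\beta)$ and $(X^{(m+1)},\beta^{(m+1)})=(\overline{X^{(m)}},\overline{\beta^{(m)}})$. Then $P_m$ is the SCP of $g$ viewed as an element of $GS_2(I,X^{(m)},\beta^{(m)})$, its coefficients being obtained by $m$ successive applications of the algorithm. *)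

(* Defs.v *)
From Stdlib Require Import Reals List Arith.
Import ListNotations.
Open Scope R_scope.

Definition Icc (p q t : R) : Prop := p <= t <= q.

(* [D_in] and [continue_in] are relative to the closed interval, so at p and q
   the derivative is one-sided; for p < q, [df] is determined on [p, q]. *)
Definition C1_on (p q : R) (f df : R -> R) : Prop :=
  forall t, Icc p q t -> D_in f df (Icc p q) t /\ continue_in df (Icc p q) t.

Definition theta_of (beta : R) : R := / 2 * (beta / (beta - 1)).

Inductive dyadic_sub (p q : R) : R -> R -> Prop :=
| dyadic_self : dyadic_sub p q p q
| dyadic_left u v : dyadic_sub p q u v -> dyadic_sub p q u ((u + v) / 2)
| dyadic_right u v : dyadic_sub p q u v -> dyadic_sub p q ((u + v) / 2) v.

Definition in_V_with (beta p q : R) (f df : R -> R) : Prop :=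
  C1_on p q f df /\
  forall u v, dyadic_sub p q u v ->
    let m := (u + v) / 2 in
    let h := v - u in
    let theta := theta_of beta in
    f m = / 2 * (f u + f v - theta * h * (df v - df u)) /\
    df m = / (1 - 2 * theta)
           * ((f v - f u) / h - 2 * theta * ((df u + df v) / 2)).

Definition in_V (beta p q : R) (f : R -> R) : Prop :=
  exists df, in_V_with beta p q f df.

Definition V_with_Bcoefs (beta p q : R) (f : R -> R) (l : list R) : Prop :=
  exists df, in_V_with beta p q f df /\
    let r := theta_of beta * (q - p) in
    l = [f p; f p + r * df p; f q - r * df q; f q].

(* The data (X, beta): [node M i] is x_i for 0 <= i <= [size M], and [beta M i]
   is beta_i for 1 <= i <= [size M]; values at other indices are irrelevant. *)
Record mesh : Type := Mesh {
  size : nat;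
  node : nat -> R;
  beta : nat -> R
}.

Definition mesh_of (a b : R) (M : mesh) : Prop :=
  (1 <= size M)%nat /\
  node M 0 = a /\ node M (size M) = b /\
  (forall i, (i < size M)%nat -> node M i < node M (S i)) /\
  (forall i, (1 <= i <= size M)%nat -> -1 <= beta M i < 0).

Definition step (M : mesh) (i : nat) : R := node M i - node M (i - 1).

Definition theta (M : mesh) (i : nat) : R := theta_of (beta M i).

Definition GS2 (a b : R) (M : mesh) (g : R -> R) : Prop :=
  (exists dg, C1_on a b g dg) /\
  forall i, (1 <= i <= size M)%nat ->
    in_V (beta M i) (node M (i - 1)) (node M i) g.

Definition omega (M : mesh) (i : nat) : R :=
  if (i =? 0)%nat then 1
  else if (i =? size M)%nat then 0
  else theta M (S i) * step M (S i)
       / (theta M i * step M i + theta M (S i) * step M (S i)).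

(* B-coefficients of B_k on I_j, for k <= 2 * size M + 1 and 1 <= j <= size M.
   Since omega_0 = 1 and omega_n = 0, the generic lists also give the four
   boundary functions B_0, B_1, B_2n, B_(2n+1). *)
Definition bspline_Bcoefs (M : mesh) (k j : nat) : list R :=
  let i := (k / 2)%nat in
  let w := omega M i in
  if Nat.even k then
    if (j =? i)%nat then [0; 0; 1; w]
    else if (j =? S i)%nat then [w; 0; 0; 0]
    else [0; 0; 0; 0]
  else
    if (j =? i)%nat then [0; 0; 0; 1 - w]
    else if (j =? S i)%nat then [1 - w; 1; 0; 0]
    else [0; 0; 0; 0].

Definition is_bspline (M : mesh) (k : nat) (f : R -> R) : Prop :=
  forall j, (1 <= j <= size M)%nat ->
    V_with_Bcoefs (beta M j) (node M (j - 1)) (node M j) f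
      (bspline_Bcoefs M k j).

Definition bspline_basis (M : mesh) (B : nat -> R -> R) : Prop :=
  forall k, (k <= 2 * size M + 1)%nat -> is_bspline M k (B k).

Definition xi (M : mesh) (i : nat) : R :=
  if (i =? 0)%nat then node M 0 else node M i - theta M i * step M i.

Definition eta (M : mesh) (i : nat) : R :=
  if (i =? size M)%nat then node M (size M)
  else node M i + theta M (S i) * step M (S i).

Definition abscissa (M : mesh) (k : nat) : R :=
  if Nat.even k then xi M (k / 2) else eta M (k / 2).

(* For t 0 < ... < t N, the polygonal line through the points (t k, c k),
   0 <= k <= N: at s the segment used is the last one starting at or before s. *)
Fixpoint polygon (t c : nat -> R) (N : nat) (s : R) : R :=
  match N with
  | O => c O
  | S k =>
      if Rle_dec (t k) s
      then c k + (s - t k) / (t (S k) - t k) * (c (S k) - c k)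
      else polygon t c k s
  end.

Definition SCP (M : mesh) (gamma : nat -> R) : R -> R :=
  polygon (abscissa M) gamma (2 * size M + 1).

Definition refine (M : mesh) : mesh := {|
  size := 2 * size M;
  node j := if Nat.even j then node M (j / 2)
            else (node M (j / 2) + node M (S (j / 2))) / 2;
  beta j := beta M (S j / 2)
|}.

(* The cases l mod 4 = 0, 1, 2, 3 are l = 4i, 4i+1, 4i-2, 4i-1 respectively. *)
Definition corner_cut (M : mesh) (gamma : nat -> R) (l : nat) : R :=
  match (l mod 4)%nat with
  | 0%nat =>
      let i := (l / 4)%nat in
      / 2 * (1 + omega M i) * gamma (2 * i)%nat
      + / 2 * (1 - omega M i) * gamma (2 * i + 1)%nat
  | 1%nat =>
      let i := (l / 4)%nat in
      / 2 * omega M i * gamma (2 * i)%nat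
      + / 2 * (2 - omega M i) * gamma (2 * i + 1)%nat
  | 2%nat =>
      let i := S (l / 4) in
      (/ 2 - / 4 * beta M i) * gamma (2 * i - 1)%nat
      + (/ 2 + / 4 * beta M i) * gamma (2 * i)%nat
  | _ =>
      let i := S (l / 4) in
      (/ 2 + / 4 * beta M i) * gamma (2 * i - 1)%nat
      + (/ 2 - / 4 * beta M i) * gamma (2 * i)%nat
  end.

Fixpoint mesh_seq (M : mesh) (m : nat) : mesh :=
  match m with O => M | S m' => refine (mesh_seq M m') end.

Fixpoint coef_seq (M : mesh) (gamma : nat -> R) (m : nat) : nat -> R :=
  match m with
  | O => gamma
  | S m' => corner_cut (mesh_seq M m') (coef_seq M gamma m')
  end.

Definition SCP_seq (M : mesh) (gamma : nat -> R) (m : nat) : R -> R :=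
  SCP (mesh_seq M m) (coef_seq M gamma m).

Definition converges_uniformly_on (a b : R) (P : nat -> R -> R) (g : R -> R)
  : Prop :=
  forall eps, 0 < eps ->
    exists N, forall m, (N <= m)%nat ->
      forall t, Icc a b t -> Rabs (P m t - g t) < eps.

(* Main.v *)
Require Import Defs.
From Stdlib Require Import Reals List Arith Lia Lra.
Import ListNotations.
Open Scope R_scope.

(** The B-spline coefficients of [g] are values of its tangent lines: writing
    [y] for the node number [k / 2] and [dg] for the derivative of [g],
    [gamma k = g y + (abscissa M k - y) * dg y]. In other words the control
    point number [k] lies on the tangent to the graph of [g] at [y]. This
    property, [taylor_coefs], carries the whole proof.

    It holds initially ([taylor_coefs_bspline]) because the B-coefficients of
    [g] on a cell are the combinations, with weights [gamma], of those of the
    B-splines, and the two inner B-coefficients of a cell are tangent values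
    at its endpoints. It survives a corner-cutting step
    ([taylor_coefs_corner_cut]). At an old node the weights [omega] only halve
    the distance of the two abscissae to the node while moving the control
    points along the tangent. At a midpoint the value and slope of [g] are
    given by the two defining relations of the space V, which say precisely
    that the new control points on the segment joining the two inner control
    points of the cell are on the tangent to [g] there.

    After [m] steps the cells have length at most [H = (b - a) / 2 ^ m]. A
    point [t] lies between two consecutive abscissae, and the polygon at [t]
    is a convex combination of the two corresponding coefficients. Each is
    within [H * sup |dg|] of a value of [g] at a node no further than [3 * H]
    from [t]. Since [dg] is bounded and [g] is uniformly continuous on [[a, b]],
    the distance to [g t] tends to 0 uniformly ([SCP_near] and
    [SCP_seq_converges]). *)

(** * Parity of indices *)

Lemma even_index k :
  (exists i, k = 2 * i)%nat \/ (exists i, k = 2 * i + 1)%nat.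
Proof.
  destruct (Nat.Even_or_Odd k) as [[i ->] | [i ->]]; [left | right]; now exists i.
Qed.

Lemma half_double i : (2 * i / 2 = i)%nat.
Proof. symmetry. apply Nat.div_unique with 0%nat; lia. Qed.

Lemma half_double_succ i : ((2 * i + 1) / 2 = i)%nat.
Proof. symmetry. apply Nat.div_unique with 1%nat; lia. Qed.

Lemma abscissa_even M i : abscissa M (2 * i) = xi M i.
Proof. unfold abscissa. now rewrite Nat.even_even, half_double. Qed.

Lemma abscissa_odd M i : abscissa M (2 * i + 1) = eta M i.
Proof. unfold abscissa. now rewrite Nat.even_odd, half_double_succ. Qed.

(** * Nodes and abscissae of a mesh *)

Lemma theta_of_bounds be : -1 <= be < 0 -> 0 < theta_of be <= / 4.
Proof.
  intros [h1 h2]. unfold theta_of.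
  replace (/ 2 * (be / (be - 1))) with ((- be) / (2 * (1 - be))) by (field; lra).
  split.
  - apply Rdiv_lt_0_compat; lra.
  - apply Rmult_le_reg_r with (2 * (1 - be)); [lra |].
    unfold Rdiv. rewrite Rmult_assoc, Rinv_l; lra.
Qed.

Lemma mesh_node_mono a b M i j :
  mesh_of a b M -> (i <= j <= size M)%nat -> node M i <= node M j.
Proof.
  intros (_ & _ & _ & hlt & _) [hij hj].
  induction hij as [| j hij IH]; [lra |].
  specialize (IH ltac:(lia)). specialize (hlt j ltac:(lia)). lra.
Qed.

Lemma mesh_node_Icc a b M i :
  mesh_of a b M -> (i <= size M)%nat -> Icc a b (node M i).
Proof.
  intros hM hi. pose proof hM as (_ & h0 & hn & _). split.
  - rewrite <- h0. apply (mesh_node_mono a b); [assumption | lia].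
  - rewrite <- hn. apply (mesh_node_mono a b); [assumption | lia].
Qed.

Lemma mesh_step_pos a b M i :
  mesh_of a b M -> (1 <= i <= size M)%nat -> 0 < step M i.
Proof.
  intros (_ & _ & _ & hlt & _) hi. unfold step.
  specialize (hlt (i - 1)%nat ltac:(lia)).
  replace (S (i - 1)) with i in hlt by lia. lra.
Qed.

Lemma mesh_theta_bounds a b M i :
  mesh_of a b M -> (1 <= i <= size M)%nat -> 0 < theta M i <= / 4.
Proof. intros (_ & _ & _ & _ & hbe) hi. now apply theta_of_bounds, hbe. Qed.

Lemma mesh_offset_bounds a b M i :
  mesh_of a b M -> (1 <= i <= size M)%nat ->
  0 < theta M i * step M i <= / 4 * step M i.
Proof.
  intros hM hi.
  pose proof (mesh_step_pos _ _ _ _ hM hi).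
  pose proof (mesh_theta_bounds _ _ _ _ hM hi). nra.
Qed.

Lemma xi_0 M : xi M 0 = node M 0.
Proof. reflexivity. Qed.

Lemma xi_pos M i : (1 <= i)%nat -> xi M i = node M i - theta M i * step M i.
Proof. destruct i; [lia | reflexivity]. Qed.

Lemma eta_size M : eta M (size M) = node M (size M).
Proof. unfold eta. now rewrite Nat.eqb_refl. Qed.

Lemma eta_lt M i :
  (i < size M)%nat -> eta M i = node M i + theta M (S i) * step M (S i).
Proof. intros hi. unfold eta. destruct (Nat.eqb_spec i (size M)); [lia | reflexivity]. Qed.

Lemma xi_lt_eta a b M i :
  mesh_of a b M -> (i <= size M)%nat ->
  xi M i <= node M i <= eta M i /\ xi M i < eta M i.
Proof.
  intros hM hi. pose proof hM as (hn & _).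
  pose proof (fun j => mesh_offset_bounds a b M j hM) as hoff.
  destruct (Nat.eq_dec i 0) as [hi0 | hi0].
  - subst i. rewrite xi_0, eta_lt by lia. specialize (hoff 1%nat ltac:(lia)). lra.
  - rewrite xi_pos by lia. pose proof (hoff i ltac:(lia)).
    destruct (Nat.eq_dec i (size M)) as [hin | hin].
    + subst i. rewrite eta_size. lra.
    + rewrite eta_lt by lia. pose proof (hoff (S i) ltac:(lia)). lra.
Qed.

Lemma eta_lt_xi_succ a b M i :
  mesh_of a b M -> (i < size M)%nat -> eta M i < xi M (S i).
Proof.
  intros hM hi. rewrite eta_lt, xi_pos by lia.
  pose proof (mesh_offset_bounds a b M (S i) hM ltac:(lia)).
  pose proof (mesh_step_pos a b M (S i) hM ltac:(lia)).
  assert (node M (S i) = node M i + step M (S i)).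
  { unfold step. replace (S i - 1)%nat with i by lia. ring. }
  lra.
Qed.

Lemma abscissa_lt_succ a b M k :
  mesh_of a b M -> (k < 2 * size M + 1)%nat -> abscissa M k < abscissa M (S k).
Proof.
  intros hM hk. destruct (even_index k) as [[i ->] | [i ->]].
  - replace (S (2 * i)) with (2 * i + 1)%nat by lia.
    rewrite abscissa_even, abscissa_odd.
    apply (xi_lt_eta a b); [assumption | lia].
  - replace (S (2 * i + 1)) with (2 * S i)%nat by lia.
    rewrite abscissa_even, abscissa_odd.
    apply (eta_lt_xi_succ a b); [assumption | lia].
Qed.

(** The weight [omega] is the one that makes the node the barycentre of its two
    neighbouring abscissae; with the boundary conventions this also holds at
    the two ends. *)
Lemma omega_barycentre a b M i :
  mesh_of a b M -> (i <= size M)%nat ->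
  omega M i * (xi M i - node M i) + (1 - omega M i) * (eta M i - node M i) = 0.
Proof.
  intros hM hi. pose proof hM as (hn & _).
  unfold omega. destruct (Nat.eqb_spec i 0) as [hi0 | hi0].
  - subst i. rewrite xi_0. ring.
  - destruct (Nat.eqb_spec i (size M)) as [hin | hin].
    + subst i. rewrite eta_size. ring.
    + rewrite xi_pos, eta_lt by lia.
      pose proof (mesh_offset_bounds a b M i hM ltac:(lia)).
      pose proof (mesh_offset_bounds a b M (S i) hM ltac:(lia)).
      field. lra.
Qed.

Definition mesh_width_le (M : mesh) (H : R) : Prop :=
  forall i, (1 <= i <= size M)%nat -> step M i <= H.

Lemma xi_near_node a b M H i :
  mesh_of a b M -> mesh_width_le M H -> (i <= size M)%nat ->
  - H <= xi M i - node M i <= H.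
Proof.
  intros hM hH hi. pose proof hM as (hn & _).
  pose proof (mesh_step_pos a b M 1 hM ltac:(lia)).
  pose proof (hH 1%nat ltac:(lia)).
  destruct (Nat.eq_dec i 0) as [-> | hi0].
  - rewrite xi_0. lra.
  - rewrite xi_pos by lia.
    pose proof (mesh_offset_bounds a b M i hM ltac:(lia)).
    pose proof (hH i ltac:(lia)). lra.
Qed.

Lemma eta_near_node a b M H i :
  mesh_of a b M -> mesh_width_le M H -> (i <= size M)%nat ->
  - H <= eta M i - node M i <= H.
Proof.
  intros hM hH hi. pose proof hM as (hn & _).
  pose proof (mesh_step_pos a b M 1 hM ltac:(lia)).
  pose proof (hH 1%nat ltac:(lia)).
  destruct (Nat.eq_dec i (size M)) as [-> | hin].
  - rewrite eta_size. lra.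
  - rewrite eta_lt by lia.
    pose proof (mesh_offset_bounds a b M (S i) hM ltac:(lia)).
    pose proof (hH (S i) ltac:(lia)). lra.
Qed.

Lemma abscissa_near_node a b M H k :
  mesh_of a b M -> mesh_width_le M H -> (k <= 2 * size M + 1)%nat ->
  Rabs (abscissa M k - node M (k / 2)) <= H.
Proof.
  intros hM hH hk. destruct (even_index k) as [[i ->] | [i ->]].
  - rewrite abscissa_even, half_double.
    apply Rabs_le, (xi_near_node a b); auto; lia.
  - rewrite abscissa_odd, half_double_succ.
    apply Rabs_le, (eta_near_node a b); auto; lia.
Qed.

Lemma abscissa_gap a b M H k :
  mesh_of a b M -> mesh_width_le M H -> (k < 2 * size M + 1)%nat ->
  abscissa M (S k) - abscissa M k <= 2 * H.
Proof.
  intros hM hH hk. destruct (even_index k) as [[i ->] | [i ->]].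
  - replace (S (2 * i)) with (2 * i + 1)%nat by lia.
    rewrite abscissa_even, abscissa_odd.
    pose proof (xi_near_node a b M H i hM hH ltac:(lia)).
    pose proof (eta_near_node a b M H i hM hH ltac:(lia)).
    lra.
  - replace (S (2 * i + 1)) with (2 * S i)%nat by lia.
    rewrite abscissa_even, abscissa_odd.
    pose proof (xi_lt_eta a b M i hM ltac:(lia)).
    pose proof (xi_lt_eta a b M (S i) hM ltac:(lia)).
    pose proof (hH (S i) ltac:(lia)).
    pose proof (mesh_step_pos a b M (S i) hM ltac:(lia)).
    unfold step in *. replace (S i - 1)%nat with i in * by lia. lra.
Qed.

(** * Refinement of a mesh *)

Lemma node_refine_even M i : node (refine M) (2 * i) = node M i.
Proof. cbn [node refine]. now rewrite Nat.even_even, half_double. Qed.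

Lemma node_refine_odd M i :
  node (refine M) (2 * i + 1) = (node M i + node M (S i)) / 2.
Proof. cbn [node refine]. now rewrite Nat.even_odd, half_double_succ. Qed.

Lemma beta_refine_even M i : beta (refine M) (2 * i) = beta M i.
Proof.
  cbn [beta refine]. replace (S (2 * i)) with (2 * i + 1)%nat by lia.
  now rewrite half_double_succ.
Qed.

Lemma beta_refine_odd M i : beta (refine M) (2 * i + 1) = beta M (S i).
Proof.
  cbn [beta refine]. replace (S (2 * i + 1)) with (2 * S i)%nat by lia.
  now rewrite half_double.
Qed.

Lemma step_refine_even M i : step (refine M) (2 * S i) = step M (S i) / 2.
Proof.
  unfold step. replace (2 * S i - 1)%nat with (2 * i + 1)%nat by lia.
  replace (S i - 1)%nat with i by lia.
  rewrite node_refine_even, node_refine_odd. field.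
Qed.

Lemma step_refine_odd M i : step (refine M) (2 * i + 1) = step M (S i) / 2.
Proof.
  unfold step. replace (2 * i + 1 - 1)%nat with (2 * i)%nat by lia.
  replace (S i - 1)%nat with i by lia.
  rewrite node_refine_even, node_refine_odd. field.
Qed.

Lemma subinterval_index j n :
  (1 <= j <= 2 * n)%nat ->
  exists i, (i < n)%nat /\ (j = 2 * i + 1 \/ j = 2 * S i)%nat.
Proof.
  intros hj. destruct (even_index j) as [[i ->] | [i ->]].
  - exists (i - 1)%nat. lia.
  - exists i. lia.
Qed.

Lemma mesh_of_refine a b M : mesh_of a b M -> mesh_of a b (refine M).
Proof.
  intros (hn & h0 & hb & hlt & hbe). repeat split.
  - cbn [size refine]. lia.
  - exact h0.
  - cbn [size refine]. now rewrite node_refine_even.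
  - cbn [size refine]. intros j hj.
    destruct (even_index j) as [[i ->] | [i ->]];
      specialize (hlt i ltac:(lia)).
    + replace (S (2 * i)) with (2 * i + 1)%nat by lia.
      rewrite node_refine_even, node_refine_odd. lra.
    + replace (S (2 * i + 1)) with (2 * S i)%nat by lia.
      rewrite node_refine_even, node_refine_odd. lra.
  - destruct (subinterval_index i (size M)) as (i' & hi & [-> | ->]);
      [assumption | rewrite beta_refine_odd | rewrite beta_refine_even];
      apply hbe; lia.
  - destruct (subinterval_index i (size M)) as (i' & hi & [-> | ->]);
      [assumption | rewrite beta_refine_odd | rewrite beta_refine_even];
      apply hbe; lia.
Qed.

Lemma mesh_width_refine M H :
  mesh_width_le M H -> mesh_width_le (refine M) (H / 2).
Proof.
  intros hH j hj. destruct (subinterval_index j (size M)) as (i & hi & [-> | ->]);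
    [assumption | rewrite step_refine_odd | rewrite step_refine_even];
    specialize (hH (S i) ltac:(lia)); lra.
Qed.

Lemma xi_refine_even M i :
  xi (refine M) (2 * i) - node M i = (xi M i - node M i) / 2.
Proof.
  destruct i as [| i].
  - rewrite xi_0. unfold xi. simpl. field.
  - rewrite !xi_pos by lia. unfold theta.
    rewrite step_refine_even, beta_refine_even, node_refine_even. field.
Qed.

Lemma eta_refine_even M i :
  (i <= size M)%nat ->
  eta (refine M) (2 * i) - node M i = (eta M i - node M i) / 2.
Proof.
  intros hi. destruct (Nat.eq_dec i (size M)) as [-> | hin].
  - change (2 * size M)%nat with (size (refine M)). rewrite !eta_size.
    cbn [size refine]. rewrite node_refine_even. field.
  - rewrite !eta_lt by (cbn [size refine]; lia). unfold theta.
    replace (S (2 * i)) with (2 * i + 1)%nat by lia.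
    rewrite step_refine_odd, beta_refine_odd, node_refine_even. field.
Qed.

Lemma xi_refine_odd M i :
  xi (refine M) (2 * i + 1) - node (refine M) (2 * i + 1)
  = - (theta M (S i) * step M (S i) / 2).
Proof.
  rewrite xi_pos by lia. unfold theta.
  rewrite step_refine_odd, beta_refine_odd. field.
Qed.

Lemma eta_refine_odd M i :
  (i < size M)%nat ->
  eta (refine M) (2 * i + 1) - node (refine M) (2 * i + 1)
  = theta M (S i) * step M (S i) / 2.
Proof.
  intros hi. rewrite eta_lt by (cbn [size refine]; lia). unfold theta.
  replace (S (2 * i + 1)) with (2 * S i)%nat by lia.
  rewrite step_refine_even, beta_refine_even. field.
Qed.

(** * Merrien relations and tangent coefficients *)

Definition merrien_relations (be u v : R) (f df : R -> R) : Prop :=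
  let m := (u + v) / 2 in
  let h := v - u in
  f m = / 2 * (f u + f v - theta_of be * h * (df v - df u)) /\
  df m = / (1 - 2 * theta_of be)
         * ((f v - f u) / h - 2 * theta_of be * ((df u + df v) / 2)).

(** A single derivative [df] serves all cells, unlike in [in_V], where each cell
    comes with its own. *)
Definition merrien_on (M : mesh) (f df : R -> R) : Prop :=
  forall i, (1 <= i <= size M)%nat ->
  forall u v, dyadic_sub (node M (i - 1)) (node M i) u v ->
    merrien_relations (beta M i) u v f df.

Lemma dyadic_sub_trans p q u v s t :
  dyadic_sub p q u v -> dyadic_sub u v s t -> dyadic_sub p q s t.
Proof. intros h1 h2. induction h2; [assumption | now constructor | now constructor]. Qed.

Lemma dyadic_sub_incl p q u v :
  p <= q -> dyadic_sub p q u v -> p <= u /\ u <= v /\ v <= q.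
Proof. intros hpq h. induction h; lra. Qed.

Lemma merrien_on_refine M f df : merrien_on M f df -> merrien_on (refine M) f df.
Proof.
  intros hf j hj u v huv.
  destruct (subinterval_index j (size M)) as (i & hi & [-> | ->]); [assumption | |].
  - replace (2 * i + 1 - 1)%nat with (2 * i)%nat in huv by lia.
    rewrite node_refine_even, node_refine_odd in huv. rewrite beta_refine_odd.
    apply hf; [lia |]. replace (S i - 1)%nat with i by lia.
    eapply dyadic_sub_trans; [| exact huv]. apply dyadic_left, dyadic_self.
  - replace (2 * S i - 1)%nat with (2 * i + 1)%nat in huv by lia.
    rewrite node_refine_even, node_refine_odd in huv. rewrite beta_refine_even.
    apply hf; [lia |]. replace (S i - 1)%nat with i by lia.
    eapply dyadic_sub_trans; [| exact huv]. apply dyadic_right, dyadic_self.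
Qed.

(** The control points lie on tangents to the graph of [f]: two of them on the
    tangent at each node. *)
Definition taylor_coefs (M : mesh) (f df : R -> R) (c : nat -> R) : Prop :=
  forall k, (k <= 2 * size M + 1)%nat ->
    c k = f (node M (k / 2)) + (abscissa M k - node M (k / 2)) * df (node M (k / 2)).

Lemma taylor_coefs_even M f df c i :
  taylor_coefs M f df c -> (i <= size M)%nat ->
  c (2 * i)%nat = f (node M i) + (xi M i - node M i) * df (node M i).
Proof.
  intros hc hi. rewrite hc, abscissa_even, half_double by lia. reflexivity.
Qed.

Lemma taylor_coefs_odd M f df c i :
  taylor_coefs M f df c -> (i <= size M)%nat ->
  c (2 * i + 1)%nat = f (node M i) + (eta M i - node M i) * df (node M i).
Proof.
  intros hc hi. rewrite hc, abscissa_odd, half_double_succ by lia. reflexivity.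
Qed.

Lemma taylor_coefs_intro M f df c :
  (forall i, (i <= size M)%nat ->
     c (2 * i)%nat = f (node M i) + (xi M i - node M i) * df (node M i) /\
     c (2 * i + 1)%nat = f (node M i) + (eta M i - node M i) * df (node M i)) ->
  taylor_coefs M f df c.
Proof.
  intros h k hk. destruct (even_index k) as [[i ->] | [i ->]].
  - rewrite abscissa_even, half_double. apply h. lia.
  - rewrite abscissa_odd, half_double_succ. apply h. lia.
Qed.

Lemma corner_cut_node M c i :
  corner_cut M c (2 * (2 * i))
    = / 2 * (1 + omega M i) * c (2 * i)%nat
      + / 2 * (1 - omega M i) * c (2 * i + 1)%nat /\
  corner_cut M c (2 * (2 * i) + 1)
    = / 2 * omega M i * c (2 * i)%nat
      + / 2 * (2 - omega M i) * c (2 * i + 1)%nat.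
Proof.
  unfold corner_cut. split.
  - replace ((2 * (2 * i)) mod 4)%nat with 0%nat by (apply Nat.mod_unique with i; lia).
    replace ((2 * (2 * i)) / 4)%nat with i by (apply Nat.div_unique with 0%nat; lia).
    reflexivity.
  - replace ((2 * (2 * i) + 1) mod 4)%nat with 1%nat by (apply Nat.mod_unique with i; lia).
    replace ((2 * (2 * i) + 1) / 4)%nat with i by (apply Nat.div_unique with 1%nat; lia).
    reflexivity.
Qed.

Lemma corner_cut_midpoint M c i :
  corner_cut M c (2 * (2 * i + 1))
    = (/ 2 - / 4 * beta M (S i)) * c (2 * i + 1)%nat
      + (/ 2 + / 4 * beta M (S i)) * c (2 * S i)%nat /\
  corner_cut M c (2 * (2 * i + 1) + 1)
    = (/ 2 + / 4 * beta M (S i)) * c (2 * i + 1)%nat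
      + (/ 2 - / 4 * beta M (S i)) * c (2 * S i)%nat.
Proof.
  unfold corner_cut. split.
  - replace ((2 * (2 * i + 1)) mod 4)%nat with 2%nat by (apply Nat.mod_unique with i; lia).
    replace ((2 * (2 * i + 1)) / 4)%nat with i by (apply Nat.div_unique with 2%nat; lia).
    cbv zeta. now replace (2 * S i - 1)%nat with (2 * i + 1)%nat by lia.
  - replace ((2 * (2 * i + 1) + 1) mod 4)%nat with 3%nat
      by (apply Nat.mod_unique with i; lia).
    replace ((2 * (2 * i + 1) + 1) / 4)%nat with i by (apply Nat.div_unique with 3%nat; lia).
    cbv zeta. now replace (2 * S i - 1)%nat with (2 * i + 1)%nat by lia.
Qed.

(** At an old node, both new coefficients are affine combinations of two points
    of one tangent, and [omega_barycentre] locates them. At a midpoint the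
    Merrien relations say that [f] takes there the mean of the two inner
    B-coefficients of the cell, with slope their divided difference over the
    distance [(1 - 2 theta) h] of their abscissae: the tangent at the midpoint
    is the line through these two control points, and
    [beta = - 2 theta / (1 - 2 theta)] turns the weights of the algorithm into
    the new abscissae. *)
Lemma taylor_coefs_corner_cut a b M f df c :
  mesh_of a b M -> merrien_on M f df -> taylor_coefs M f df c ->
  taylor_coefs (refine M) f df (corner_cut M c).
Proof.
  intros hM hf hc. apply taylor_coefs_intro. intros j hj. cbn [size refine] in hj.
  destruct (even_index j) as [[i ->] | [i ->]].
  - destruct (corner_cut_node M c i) as [-> ->].
    rewrite node_refine_even, xi_refine_even, eta_refine_even by lia.
    rewrite (taylor_coefs_even M f df c i hc), (taylor_coefs_odd M f df c i hc) by lia.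
    pose proof (omega_barycentre a b M i hM ltac:(lia)) as hw.
    split; nra.
  - destruct (corner_cut_midpoint M c i) as [-> ->].
    rewrite xi_refine_odd, eta_refine_odd, node_refine_odd by lia.
    rewrite (taylor_coefs_even M f df c (S i) hc), (taylor_coefs_odd M f df c i hc) by lia.
    rewrite xi_pos, eta_lt by lia.
    pose proof (mesh_step_pos a b M (S i) hM ltac:(lia)) as hpos.
    pose proof hM as (_ & _ & _ & _ & hbe). specialize (hbe (S i) ltac:(lia)).
    destruct (hf (S i) ltac:(lia) _ _ (dyadic_self _ _)) as [hm hdm].
    unfold step, theta in *. replace (S i - 1)%nat with i in * by lia.
    rewrite hm, hdm. unfold theta_of. split; field; lra.
Qed.

(** * Distance from a control polygon to the function *)

Lemma polygon_near t c N s v e :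
  (0 < N)%nat ->
  (forall k, (k < N)%nat -> t k < t (S k)) ->
  t 0%nat <= s <= t N ->
  (forall k, (k < N)%nat -> t k <= s <= t (S k) ->
     Rabs (c k - v) <= e /\ Rabs (c (S k) - v) <= e) ->
  Rabs (polygon t c N s - v) <= e.
Proof.
  induction N as [| N IH]; [lia |]. intros _ hlt [hs0 hsN] hc. cbn [polygon].
  destruct (Rle_dec (t N) s) as [hle | hnle].
  - destruct (hc N ltac:(lia) (conj hle hsN)) as [h1 h2].
    specialize (hlt N ltac:(lia)).
    set (lam := (s - t N) / (t (S N) - t N)).
    assert (0 <= lam).
    { apply Rmult_le_pos; [lra | left; apply Rinv_0_lt_compat; lra]. }
    assert (lam <= 1).
    { apply Rmult_le_reg_r with (t (S N) - t N); [lra |].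
      unfold lam, Rdiv. rewrite Rmult_assoc, Rinv_l; lra. }
    replace (c N + lam * (c (S N) - c N) - v)
      with ((1 - lam) * (c N - v) + lam * (c (S N) - v)) by ring.
    eapply Rle_trans; [apply Rabs_triang |]. rewrite !Rabs_mult.
    rewrite (Rabs_right (1 - lam)), (Rabs_right lam) by lra. nra.
  - destruct N as [| N]; [lra |].
    apply IH; [lia | intros; apply hlt; lia | lra | intros; apply hc; [lia | lra]].
Qed.

Lemma abscissa_first M : abscissa M 0 = node M 0.
Proof. reflexivity. Qed.

Lemma abscissa_last M : abscissa M (2 * size M + 1) = node M (size M).
Proof. rewrite abscissa_odd. apply eta_size. Qed.

(** The coefficients of the polygon near [t] come from nodes at distance at most
    [H] from abscissae that are themselves within [2 * H] of [t]. *)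
Lemma SCP_near a b M H f df c t e C :
  mesh_of a b M -> mesh_width_le M H -> taylor_coefs M f df c ->
  (forall s, Icc a b s -> Rabs (s - t) <= 3 * H -> Rabs (f s - f t) <= e) ->
  (forall s, Icc a b s -> Rabs (df s) <= C) ->
  Icc a b t ->
  Rabs (SCP M c t - f t) <= e + H * C.
Proof.
  intros hM hH hc hf hdf ht.
  assert (hcoef : forall k, (k <= 2 * size M + 1)%nat ->
            Rabs (abscissa M k - t) <= 2 * H -> Rabs (c k - f t) <= e + H * C).
  { intros k hk hkt. rewrite hc by assumption.
    pose proof (abscissa_near_node a b M H k hM hH hk) as hnear.
    assert (hy : Icc a b (node M (k / 2))).
    { apply mesh_node_Icc; [assumption |].
      apply Nat.lt_succ_r, Nat.Div0.div_lt_upper_bound; lia. }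
    set (y := node M (k / 2)) in *.
    replace (f y + (abscissa M k - y) * df y - f t)
      with ((f y - f t) + (abscissa M k - y) * df y) by ring.
    eapply Rle_trans; [apply Rabs_triang |]. apply Rplus_le_compat.
    - apply hf; [assumption |].
      replace (y - t) with ((abscissa M k - t) - (abscissa M k - y)) by ring.
      eapply Rle_trans; [apply Rabs_triang |]. rewrite Rabs_Ropp. lra.
    - rewrite Rabs_mult. apply Rmult_le_compat; auto using Rabs_pos. }
  pose proof hM as (_ & h0 & hn & _).
  apply polygon_near.
  - lia.
  - intros k hk. now apply (abscissa_lt_succ a b).
  - rewrite abscissa_first, abscissa_last, h0, hn. exact ht.
  - intros k hk [hk1 hk2]. pose proof (abscissa_gap a b M H k hM hH hk).
    split; apply hcoef; try lia; apply Rabs_le; lra.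
Qed.

(** * The corner-cutting sequence *)

Lemma mesh_of_seq a b M m : mesh_of a b M -> mesh_of a b (mesh_seq M m).
Proof. intros hM. induction m; [assumption | now apply mesh_of_refine]. Qed.

Lemma merrien_on_seq M f df m : merrien_on M f df -> merrien_on (mesh_seq M m) f df.
Proof. intros hf. induction m; [assumption | now apply merrien_on_refine]. Qed.

Lemma taylor_coefs_seq a b M f df c m :
  mesh_of a b M -> merrien_on M f df -> taylor_coefs M f df c ->
  taylor_coefs (mesh_seq M m) f df (coef_seq M c m).
Proof.
  intros hM hf hc. induction m as [| m IH]; [assumption |].
  apply (taylor_coefs_corner_cut a b);
    [now apply mesh_of_seq | now apply merrien_on_seq | exact IH].
Qed.

Lemma mesh_width_seq a b M m :
  mesh_of a b M -> mesh_width_le (mesh_seq M m) ((b - a) * (/ 2) ^ m).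
Proof.
  intros hM. induction m as [| m IH].
  - intros i hi. cbn [mesh_seq pow] in *.
    destruct (mesh_node_Icc a b M i hM) as [_ h1]; [lia |].
    destruct (mesh_node_Icc a b M (i - 1) hM) as [h2 _]; [lia |].
    unfold step. lra.
  - replace ((b - a) * (/ 2) ^ S m) with ((b - a) * (/ 2) ^ m / 2)
      by (simpl; field).
    now apply mesh_width_refine.
Qed.

(** * Continuity on a closed interval *)

(** Retraction onto the interval: composing with it turns continuity relative to
    [[a, b]] into continuity on the line, to which the classical theorems on
    compact intervals apply. *)
Definition clamp (a b s : R) : R := Rmax a (Rmin b s).

Lemma clamp_Icc a b s : a <= b -> Icc a b (clamp a b s).
Proof. intros hab. unfold Icc, clamp, Rmax, Rmin. repeat destruct Rle_dec; lra. Qed.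

Lemma clamp_id a b s : Icc a b s -> clamp a b s = s.
Proof. unfold Icc, clamp, Rmax, Rmin. repeat destruct Rle_dec; lra. Qed.

Lemma clamp_contraction a b s t :
  Rabs (clamp a b s - clamp a b t) <= Rabs (s - t).
Proof.
  unfold clamp, Rmax, Rmin, Rabs.
  repeat destruct Rle_dec; repeat destruct Rcase_abs; lra.
Qed.

Lemma continuity_clamp a b f :
  a <= b -> (forall t, Icc a b t -> continue_in f (Icc a b) t) ->
  continuity (fun s => f (clamp a b s)).
Proof.
  intros hab hf x e he.
  destruct (hf _ (clamp_Icc a b x hab) e he) as (d & hd & hlim).
  exists d. split; [assumption |]. intros y [_ hy].
  destruct (Req_dec (clamp a b x) (clamp a b y)) as [heq | hne].
  - rewrite heq. now rewrite (proj2 (dist_refl R_met _ _) eq_refl).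
  - apply hlim. split; [split; [now apply clamp_Icc | exact hne] |].
    eapply Rle_lt_trans; [apply clamp_contraction | exact hy].
Qed.

Lemma bounded_on_Icc a b f :
  a <= b -> (forall t, Icc a b t -> continue_in f (Icc a b) t) ->
  exists C, forall s, Icc a b s -> Rabs (f s) <= C.
Proof.
  intros hab hf. pose proof (continuity_clamp a b f hab hf) as hcont.
  destruct (continuity_ab_maj _ a b hab (fun c _ => hcont c)) as (u & hu & _).
  destruct (continuity_ab_min _ a b hab (fun c _ => hcont c)) as (l & hl & _).
  exists (Rmax (f (clamp a b u)) (- f (clamp a b l))). intros s hs.
  specialize (hu s hs). specialize (hl s hs). cbv beta in hu, hl.
  rewrite (clamp_id a b s hs) in hu, hl.
  pose proof (Rmax_l (f (clamp a b u)) (- f (clamp a b l))).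
  pose proof (Rmax_r (f (clamp a b u)) (- f (clamp a b l))).
  apply Rabs_le. lra.
Qed.

Lemma uniformly_continuous_on_Icc a b f :
  a <= b -> (forall t, Icc a b t -> continue_in f (Icc a b) t) ->
  forall e, 0 < e -> exists d, 0 < d /\
    forall s t, Icc a b s -> Icc a b t -> Rabs (s - t) < d -> Rabs (f s - f t) < e.
Proof.
  intros hab hf e he. pose proof (continuity_clamp a b f hab hf) as hcont.
  destruct (Heine _ _ (compact_P3 a b) (fun x _ => hcont x) (mkposreal e he)) as (d & hd).
  exists d. split; [apply cond_pos |]. intros s t hs ht hst.
  specialize (hd s t hs ht hst). cbv beta in hd.
  now rewrite !clamp_id in hd.
Qed.

(** * Uniform convergence for tangent coefficients *)

Lemma SCP_seq_converges a b M f df c :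
  mesh_of a b M -> C1_on a b f df -> merrien_on M f df -> taylor_coefs M f df c ->
  converges_uniformly_on a b (SCP_seq M c) f.
Proof.
  intros hM hC1 hf hc e he.
  assert (hab : a <= b).
  { pose proof (mesh_node_Icc a b M 0 hM (Nat.le_0_l _)) as [? ?]. lra. }
  destruct (bounded_on_Icc a b df hab) as [C hC]; [intros; now apply hC1 |].
  destruct (uniformly_continuous_on_Icc a b f hab) with (e := e / 2)
    as (d & hd & hdf); [| lra |].
  { intros t ht. apply cont_deriv with df, hC1, ht. }
  (* With [H] the mesh width, both [3 * H < d] and [H * C < e / 2] follow from
     [4 * (H * (1 + Rabs C)) < Rmin d e]; [K] may vanish as far as [hab] tells,
     so [q] is a quotient by [K + 1]. *)
  set (K := (b - a) * (1 + Rabs C)).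
  assert (hK : 0 <= K).
  { apply Rmult_le_pos; [lra |]. pose proof (Rabs_pos C). lra. }
  set (q := Rmin d e / (4 * (K + 1))).
  assert (hmin : 0 < Rmin d e) by now apply Rmin_glb_lt.
  assert (hq : 0 < q) by (apply Rdiv_lt_0_compat; lra).
  destruct (pow_lt_1_zero (/ 2) ltac:(rewrite Rabs_right; lra) q hq) as [N hN].
  exists N. intros m hm t ht. specialize (hN m hm).
  assert (hpow : 0 < (/ 2) ^ m) by (apply pow_lt; lra).
  rewrite Rabs_right in hN by lra.
  assert (hwidth : 4 * (K * (/ 2) ^ m) < Rmin d e).
  { apply Rle_lt_trans with (4 * (K + 1) * (/ 2) ^ m); [nra |].
    replace (Rmin d e) with (4 * (K + 1) * q) by (unfold q; field; lra).
    apply Rmult_lt_compat_l; lra. }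
  set (H := (b - a) * (/ 2) ^ m) in *.
  assert (hH : 0 <= H) by (apply Rmult_le_pos; lra).
  replace (K * (/ 2) ^ m) with (H * (1 + Rabs C)) in hwidth by (unfold H, K; ring).
  pose proof (Rmin_l d e). pose proof (Rmin_r d e).
  pose proof (Rabs_pos C). pose proof (Rle_abs C).
  apply Rle_lt_trans with (e / 2 + H * C); [| nra].
  apply (SCP_near a b _ H f df); auto.
  - now apply mesh_of_seq.
  - now apply mesh_width_seq.
  - now apply (taylor_coefs_seq a b).
  - intros s hs hst. left. apply hdf; [assumption | assumption | nra].
Qed.

(** * Derivatives relative to an interval *)

Lemma D_in_subset f df (D D' : R -> Prop) x :
  (forall y, D' y -> D y) -> D_in f df D x -> D_in f df D' x.
Proof.
  intros hsub hf e he. destruct (hf e he) as (d & hd & hlim).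
  exists d. split; [assumption |]. intros y [[hy hne] hyd].
  apply hlim. split; [split |]; auto.
Qed.

Lemma D_in_ext f g df (D : R -> Prop) x :
  (forall y, D y -> f y = g y) -> D x -> D_in f df D x -> D_in g df D x.
Proof.
  intros hfg hx hf e he. destruct (hf e he) as (d & hd & hlim).
  exists d. split; [assumption |]. intros y [[hy hne] hyd].
  rewrite <- !hfg by assumption. apply hlim. repeat split; assumption.
Qed.

Lemma D_in_Icc_unique p q f d1 d2 x :
  p < q -> Icc p q x ->
  D_in f d1 (Icc p q) x -> D_in f d2 (Icc p q) x -> d1 x = d2 x.
Proof.
  intros hpq [hx1 hx2] h1 h2.
  refine (single_limit _ _ _ _ x _ h1 h2).
  intros e he. unfold D_x, Icc, Rdist.
  destruct (Rlt_dec x q) as [hxq | hxq].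
  - exists (Rmin q (x + e / 2)).
    pose proof (Rmin_l q (x + e / 2)). pose proof (Rmin_r q (x + e / 2)).
    assert (x < Rmin q (x + e / 2)) by (apply Rmin_glb_lt; lra).
    repeat split; try lra. rewrite Rabs_right; lra.
  - exists (Rmax p (x - e / 2)).
    pose proof (Rmax_l p (x - e / 2)). pose proof (Rmax_r p (x - e / 2)).
    assert (Rmax p (x - e / 2) < x) by (apply Rmax_lub_lt; lra).
    repeat split; try lra. rewrite Rabs_left; lra.
Qed.

(** * The coefficients of a spline are tangent values *)

Lemma Icc_cell a b M i :
  mesh_of a b M -> (1 <= i <= size M)%nat ->
  forall t, Icc (node M (i - 1)) (node M i) t -> Icc a b t.
Proof.
  intros hM hi t [h1 h2].
  destruct (mesh_node_Icc a b M i hM) as [_ ?]; [lia |].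
  destruct (mesh_node_Icc a b M (i - 1) hM) as [? _]; [lia |].
  split; lra.
Qed.

(** The derivative that witnesses membership in V on a cell agrees there with the
    global one, since a cell has no isolated point. *)
Lemma merrien_on_GS2 a b M g dg :
  mesh_of a b M -> GS2 a b M g -> C1_on a b g dg -> merrien_on M g dg.
Proof.
  intros hM [_ hV] hg i hi u v huv.
  pose proof (mesh_step_pos a b M i hM hi) as hlt. unfold step in hlt.
  pose proof (Icc_cell a b M i hM hi) as hsub.
  destruct (hV i hi) as (df & hdf & hrel).
  set (p := node M (i - 1)) in *. set (q := node M i) in *.
  assert (heq : forall t, Icc p q t -> df t = dg t).
  { intros t ht. apply (D_in_Icc_unique p q g); [lra | assumption | |].
    - now apply hdf.
    - apply D_in_subset with (Icc a b); [assumption |]. now apply hg, hsub. }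
  destruct (dyadic_sub_incl p q u v ltac:(lra) huv) as (h1 & h2 & h3).
  specialize (hrel u v huv). cbv zeta in hrel.
  rewrite !heq in hrel by (split; lra). exact hrel.
Qed.

Definition Bcoefs (be p q : R) (f df : R -> R) : list R :=
  let r := theta_of be * (q - p) in
  [f p; f p + r * df p; f q - r * df q; f q].

(** B-coefficients are linear in the function. The induction on [N] builds
    the derivative of the sum from one witness at a time, instead of choosing a
    whole family of derivatives. *)
Lemma Bcoefs_combination be p q (B : nat -> R -> R) (l : nat -> list R) gamma N :
  (forall k, (k <= N)%nat -> V_with_Bcoefs be p q (B k) (l k)) ->
  exists d,
    (forall t, Icc p q t ->
       D_in (fun t => sum_f_R0 (fun k => gamma k * B k t) N) d (Icc p q) t) /\
    forall s, (s < 4)%nat ->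
      nth s (Bcoefs be p q (fun t => sum_f_R0 (fun k => gamma k * B k t) N) d) 0
      = sum_f_R0 (fun k => gamma k * nth s (l k) 0) N.
Proof.
  induction N as [| N IH]; intros hB.
  - destruct (hB 0%nat (le_n _)) as (d & (hd & _) & hl). cbv zeta in hl.
    exists (fun t => gamma 0%nat * d t). split.
    + intros t ht. apply Dmult_const, hd, ht.
    + intros s hs. cbn [sum_f_R0]. rewrite hl.
      destruct s as [| [| [| [| s]]]]; try lia; cbn; ring.
  - destruct IH as (d & hd & hs); [intros; apply hB; lia |].
    destruct (hB (S N) (le_n _)) as (d' & (hd' & _) & hl). cbv zeta in hl.
    exists (fun t => d t + gamma (S N) * d' t). split.
    + intros t ht. cbn [sum_f_R0].
      apply (Dadd _ (fun t => d t) (fun t => gamma (S N) * d' t)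
               (fun t => sum_f_R0 (fun k => gamma k * B k t) N)
               (fun t => gamma (S N) * B (S N) t)).
      * now apply hd.
      * apply Dmult_const, hd', ht.
    + intros s hs4. cbn [sum_f_R0]. rewrite <- hs, hl by assumption.
      destruct s as [| [| [| [| s]]]]; try lia; cbn; ring.
Qed.

Lemma sum_f_R0_pairs F n :
  sum_f_R0 F (2 * n + 1)
  = sum_f_R0 (fun i => F (2 * i)%nat + F (2 * i + 1)%nat) n.
Proof.
  induction n as [| n IH]; [reflexivity |].
  replace (2 * S n + 1)%nat with (S (S (2 * n + 1))) by lia.
  cbn [sum_f_R0]. rewrite IH.
  replace (S (2 * n + 1)) with (2 * S n)%nat by lia.
  replace (S (2 * S n)) with (2 * S n + 1)%nat by lia. ring.
Qed.

Lemma sum_f_R0_single F n i :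
  (i <= n)%nat -> (forall k, (k <= n)%nat -> k <> i -> F k = 0) ->
  sum_f_R0 F n = F i.
Proof.
  intros hi hF. induction n as [| n IH].
  - now replace i with 0%nat by lia.
  - cbn [sum_f_R0]. destruct (Nat.eq_dec i (S n)) as [-> | hne].
    + replace (sum_f_R0 F n) with 0; [ring |]. symmetry.
      apply sum_eq_R0. intros k hk. apply hF; lia.
    + rewrite IH, (hF (S n)) by (intros; try apply hF; lia). ring.
Qed.

Lemma bspline_Bcoefs_even M i j :
  bspline_Bcoefs M (2 * i) j
  = if (j =? i)%nat then [0; 0; 1; omega M i]
    else if (j =? S i)%nat then [omega M i; 0; 0; 0] else [0; 0; 0; 0].
Proof. unfold bspline_Bcoefs. now rewrite Nat.even_even, half_double. Qed.

Lemma bspline_Bcoefs_odd M i j :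
  bspline_Bcoefs M (2 * i + 1) j
  = if (j =? i)%nat then [0; 0; 0; 1 - omega M i]
    else if (j =? S i)%nat then [1 - omega M i; 1; 0; 0] else [0; 0; 0; 0].
Proof. unfold bspline_Bcoefs. now rewrite Nat.even_odd, half_double_succ. Qed.

(** On a cell only four B-splines are nonzero, and only the two attached to its
    left endpoint contribute to the first two B-coefficients. *)
Lemma sum_bspline_Bcoefs_left M gamma i s :
  (i < size M)%nat -> (s < 2)%nat ->
  sum_f_R0 (fun k => gamma k * nth s (bspline_Bcoefs M k (S i)) 0) (2 * size M + 1)
  = if (s =? 0)%nat
    then omega M i * gamma (2 * i)%nat + (1 - omega M i) * gamma (2 * i + 1)%nat
    else gamma (2 * i + 1)%nat.
Proof.
  intros hi hs. rewrite sum_f_R0_pairs, (sum_f_R0_single _ _ i); [| lia |].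
  - rewrite bspline_Bcoefs_even, bspline_Bcoefs_odd, Nat.eqb_refl.
    destruct (Nat.eqb_spec (S i) i); [lia |].
    destruct s as [| [| s]]; try lia; cbn; ring.
  - intros k _ hk. rewrite bspline_Bcoefs_even, bspline_Bcoefs_odd.
    destruct (Nat.eqb_spec (S i) k), (Nat.eqb_spec (S i) (S k)); try lia;
      destruct s as [| [| s]]; try lia; cbn; ring.
Qed.

Lemma sum_bspline_Bcoefs_right M gamma i s :
  (1 <= i <= size M)%nat -> (2 <= s < 4)%nat ->
  sum_f_R0 (fun k => gamma k * nth s (bspline_Bcoefs M k i) 0) (2 * size M + 1)
  = if (s =? 2)%nat then gamma (2 * i)%nat
    else omega M i * gamma (2 * i)%nat + (1 - omega M i) * gamma (2 * i + 1)%nat.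
Proof.
  intros hi hs. rewrite sum_f_R0_pairs, (sum_f_R0_single _ _ i); [| lia |].
  - rewrite bspline_Bcoefs_even, bspline_Bcoefs_odd, Nat.eqb_refl.
    destruct s as [| [| [| [| s]]]]; try lia; cbn; ring.
  - intros k _ hk. rewrite bspline_Bcoefs_even, bspline_Bcoefs_odd.
    destruct (Nat.eqb_spec i k), (Nat.eqb_spec i (S k)); try lia;
      destruct s as [| [| [| [| s]]]]; try lia; cbn; ring.
Qed.

(** [g] and the combination of the [B k] agree only on [[a, b]], but the
    derivative of [g] relative to a cell is determined by its values there. *)
Lemma Bcoefs_bspline_combination a b M g dg B gamma i s :
  mesh_of a b M -> C1_on a b g dg -> bspline_basis M B ->
  (forall t, Icc a b t ->
     g t = sum_f_R0 (fun k => gamma k * B k t) (2 * size M + 1)) ->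
  (1 <= i <= size M)%nat -> (s < 4)%nat ->
  nth s (Bcoefs (beta M i) (node M (i - 1)) (node M i) g dg) 0
  = sum_f_R0 (fun k => gamma k * nth s (bspline_Bcoefs M k i) 0) (2 * size M + 1).
Proof.
  intros hM hg hB hgamma hi hs.
  pose proof (mesh_step_pos a b M i hM hi) as hlt. unfold step in hlt.
  pose proof (Icc_cell a b M i hM hi) as hsub.
  destruct (Bcoefs_combination (beta M i) (node M (i - 1)) (node M i) B
              (fun k => bspline_Bcoefs M k i) gamma (2 * size M + 1))
    as (d & hd & hnth).
  { intros k hk. now apply hB. }
  rewrite <- hnth by assumption.
  set (p := node M (i - 1)) in *. set (q := node M i) in *.
  assert (heq : forall t, Icc p q t -> dg t = d t).
  { intros t ht. apply (D_in_Icc_unique p q g); [lra | assumption | |].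
    - apply D_in_subset with (Icc a b); [assumption |]. now apply hg, hsub.
    - eapply D_in_ext; [| exact ht | now apply hd].
      intros y hy. symmetry. now apply hgamma, hsub. }
  unfold Bcoefs. cbv zeta.
  rewrite !heq, !hgamma by (try apply hsub; split; lra). reflexivity.
Qed.

(** Each coefficient is read off as one B-coefficient on a suitable cell: the
    inner ones give the tangent values, and the two end coefficients are values
    of [g] because [omega] is 1 at the first node and 0 at the last. *)
Lemma taylor_coefs_bspline a b M g dg B gamma :
  mesh_of a b M -> C1_on a b g dg -> bspline_basis M B ->
  (forall t, Icc a b t ->
     g t = sum_f_R0 (fun k => gamma k * B k t) (2 * size M + 1)) ->
  taylor_coefs M g dg gamma.
Proof.
  intros hM hg hB hgamma. pose proof hM as (hn & _).
  pose proof (fun i s => Bcoefs_bspline_combination a b M g dg B gamma i s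
                           hM hg hB hgamma) as hcoef.
  apply taylor_coefs_intro. intros i hi. split.
  - destruct (Nat.eq_dec i 0) as [hi0 | hi0].
    + subst i. pose proof (hcoef 1%nat 0%nat ltac:(lia) ltac:(lia)) as h.
      rewrite sum_bspline_Bcoefs_left in h by lia. cbn in h.
      rewrite xi_0. cbn. lra.
    + pose proof (hcoef i 2%nat ltac:(lia) ltac:(lia)) as h.
      rewrite sum_bspline_Bcoefs_right in h by lia. cbn [nth Bcoefs Nat.eqb] in h.
      rewrite xi_pos, <- h by lia. unfold theta, step. ring.
  - destruct (Nat.eq_dec i (size M)) as [hin | hin].
    + pose proof (hcoef i 3%nat ltac:(lia) ltac:(lia)) as h.
      rewrite sum_bspline_Bcoefs_right in h by lia. cbn [nth Bcoefs Nat.eqb] in h.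
      replace (omega M i) with 0 in h.
      * rewrite hin, eta_size, <- hin, h. ring.
      * unfold omega. rewrite hin, Nat.eqb_refl.
        destruct (Nat.eqb_spec (size M) 0); [lia | reflexivity].
    + pose proof (hcoef (S i) 1%nat ltac:(lia) ltac:(lia)) as h.
      rewrite sum_bspline_Bcoefs_left in h by lia. cbn [nth Bcoefs Nat.eqb] in h.
      rewrite eta_lt, <- h by lia. unfold theta, step.
      replace (S i - 1)%nat with i by lia. ring.
Qed.

Theorem theorem8 (a b : R) (M : mesh) (hM : mesh_of a b M)
  (g : R -> R) (hg : GS2 a b M g)
  (B : nat -> R -> R) (hB : bspline_basis M B)
  (gamma : nat -> R)
  (hgamma : forall t, Icc a b t ->
     g t = sum_f_R0 (fun k => gamma k * B k t) (2 * size M + 1)) :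
  converges_uniformly_on a b (SCP_seq M gamma) g.
Proof.
  pose proof hg as [[dg hdg] _].
  apply (SCP_seq_converges a b M g dg gamma hM hdg).
  - now apply (merrien_on_GS2 a b).
  - now apply (taylor_coefs_bspline a b M g dg B).
Qed.
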